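(* The (exponential) generating function of the Lah-Bell polynomials is given by $$e^{x\left(\frac{1}{1-t}-1\right)}=\sum_{n=0}^{\infty}B_{n}^{L}(x)\frac{t^{n}}{n!},$$ as an identity of formal power series in $t$ with coefficients polynomials in $x$.
   Context: For integers $n,k\ge 0$, the unsigned Lah number $L(n,k)$ is the number of ways a set of $n$ elements can be partitioned into $k$ nonempty linearly ordered subsets (so $L(0,0)=1$, $L(n,0)=0$ for $n\ge 1$, $L(n,k)=0$ for $k>n$, and $L(n,k)=\binom{n-1}{k-1}\frac{n!}{k!}$ for $n\ge k\ge 1$). The Lah-Bell polynomials are $B_n^L(x)=\sum_{l=0}^n L(n,l)x^l$ for $n\ge 0$. *)

(* Defs.v *)
From mathcomp Require Import all_boot all_order all_algebra.

Set Implicit Arguments.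
Unset Strict Implicit.
Unset Printing Implicit Defensive.

Import GRing.Theory.

Local Open Scope ring_scope.

(* Number of partitions of 'I_n into k nonempty linearly ordered blocks.  A   *)
(* linearly ordered block is encoded as the duplicate-free sequence listing   *)
(* its elements in increasing order; the bound n on its length loses nothing  *)
(* and only serves to make the type of blocks finite.                         *)
Definition lah (n k : nat) : nat :=
  #|[set P : {set {bseq n of 'I_n}} |
      [&& #|P| == k,
          [forall s in P, (s != [::] :> seq 'I_n) && uniq s]
        & [forall i : 'I_n, #|[set s in P | i \in s]| == 1%N]]]|.

Definition lah_bell (F : fieldType) (n : nat) : {poly F} :=
  \sum_(l < n.+1) (lah n l)%:R *: 'X^l.

(* A formal power series in t over R is its coefficient sequence nat -> R, so *)
(* that f n is the coefficient of t^n.  Sums, differences and multiplication  *)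
(* by a scalar are the pointwise f \+ g, f \- g and a \*o f.                  *)
Section FormalPowerSeries.
Variable R : comUnitRingType.
Implicit Types f g : nat -> R.

Definition fps_one : nat -> R := fun n => (n == 0%N)%:R.
Definition fps_t : nat -> R := fun n => (n == 1%N)%:R.

Definition fps_mul f g : nat -> R :=
  fun n => \sum_(i < n.+1) f i * g (n - i)%N.

Definition fps_pow f k : nat -> R := iter k (fps_mul f) fps_one.

(* The first n coefficients of 1 / f: the m-th one is obtained by solving     *)
(* \sum_(i <= m) f (m - i) * g i = (m == 0) for g m.  See fps_mulfV.          *)
Fixpoint fps_inv_seq f n : seq R :=
  if n is m.+1 then
    let s := fps_inv_seq f m in
    rcons s ((f 0%N)^-1 * ((m == 0%N)%:R - \sum_(i < m) f (m - i)%N * s`_i))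
  else [::].

Definition fps_inv f : nat -> R := fun n => (fps_inv_seq f n.+1)`_n.

(* exp f = \sum_k f^k / k!, for f with zero constant coefficient (and k! all  *)
(* units of R); the terms with k > n then do not contribute to the            *)
(* coefficient of t^n.  See fps_exp_sum.                                      *)
Definition fps_exp f : nat -> R :=
  fun n => \sum_(k < n.+1) fps_pow f k n / k`!%:R.

(* \sum_n a_n t^n / n!                                                        *)
Definition fps_egf (a : nat -> R) : nat -> R := fun n => a n / n`!%:R.

Lemma size_fps_inv_seq f n : size (fps_inv_seq f n) = n.
Proof. by elim: n => //= n IH; rewrite size_rcons IH. Qed.

Lemma nth_fps_inv_seq f n i : (i < n)%N -> (fps_inv_seq f n)`_i = fps_inv f i.
Proof.
elim: n => //= n IH; rewrite ltnS nth_rcons size_fps_inv_seq leq_eqVlt.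
case/predU1P=> [-> | lt_in]; last by rewrite lt_in IH.
by rewrite ltnn eqxx /fps_inv /= nth_rcons size_fps_inv_seq ltnn eqxx.
Qed.

Lemma fps_mulfV f :
  f 0%N \is a GRing.unit -> fps_mul f (fps_inv f) =1 fps_one.
Proof.
move=> Uf n; rewrite /fps_mul big_ord_recl /= subn0.
rewrite {1}/fps_inv /= nth_rcons size_fps_inv_seq ltnn eqxx mulVKr //.
rewrite [X in _ + X](_ : _ =
  \sum_(i < n) f (n - i)%N * (fps_inv_seq f n)`_i) ?subrK //.
rewrite (reindex_inj rev_ord_inj) /=; apply: eq_bigr => i _.
rewrite nth_fps_inv_seq // /bump /= add1n subnSK //.
by rewrite subKn // ltnW.
Qed.

Lemma fps_pow_small f k n : f 0%N = 0 -> (n < k)%N -> fps_pow f k n = 0.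
Proof.
move=> f0; elim: k n => //= k IH n lt_nk.
rewrite /fps_pow /= /fps_mul big1 // => -[i /= lt_in] _.
case: i lt_in => [|i] lt_in; first by rewrite f0 mul0r.
rewrite [X in _ * X]IH ?mulr0 // (leq_trans _ (lt_nk : n <= k)%N) //.
by rewrite ltn_subrL /=; apply: leq_trans (lt_in : i < n)%N.
Qed.

Lemma fps_exp_sum f n N : f 0%N = 0 -> (n < N)%N ->
  \sum_(k < N) fps_pow f k n / k`!%:R = fps_exp f n.
Proof.
move=> f0 lt_nN; rewrite /fps_exp.
rewrite -!(big_mkord xpredT (fun k => fps_pow f k n / k`!%:R)).
rewrite (big_cat_nat (n := n.+1)) //= -[RHS]addr0; congr (_ + _).
rewrite big_nat_cond big1 // => k /andP[/andP[lt_nk _] _].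
by rewrite fps_pow_small ?mul0r.
Qed.

End FormalPowerSeries.

Arguments fps_one {R}.
Arguments fps_t {R}.

(* Main.v *)
Require Import Defs.
From mathcomp Require Import all_boot all_order all_algebra.

Import GRing.Theory.
Local Open Scope ring_scope.

(** The coefficient of [t^n] in [(x (1/(1-t) - 1))^k = x^k (t + t^2 + ...)^k] is
    [x^k] times the number [c] of compositions of [n] into [k] positive parts
    ([fps_pow_geometric]), so the theorem amounts, term by term, to the identity
    [L(n,k) k! = n! c] ([lah_fact]).

    Both sides of this identity count the sequences of [k] nonempty lists whose
    concatenation is an arrangement of the [n] elements.  On one side, such a
    sequence is a partition into [k] linearly ordered blocks together with one
    of the [k!] orders of the blocks ([mem_ordered_blocks]).  On the other side,
    it is one of the [n!] arrangements of the elements, cut into consecutive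
    pieces whose lengths form a composition of [n] ([mem_cut_arrangements]).
    The enumerations behind the two descriptions have no repetitions, hence
    the same length.  In characteristic 0 the factorials are then invertible
    scalars, and the identity can be divided by [k! n!]. *)

(** * Compositions and powers of the geometric series *)

Fixpoint compositions k n : seq (seq nat) :=
  if k is k'.+1 then
    [seq i :: c | i <- iota 1 n, c <- compositions k' (n - i)%N]
  else nseq (n == 0%N) [::].

Lemma mem_compositions k n c :
  (c \in compositions k n) = [&& size c == k, all (ltn 0) c & sumn c == n].
Proof.
elim: k n c => [|k IH] n c /=.
  by case: c => [|i c]; case: n.
apply/allpairsPdep/idP => [[i [d [+ + ->]]]|].
  rewrite mem_iota IH add1n ltnS /= => /andP[-> le_in].
  by case/and3P=> /eqP-> -> /eqP->; rewrite subnKC ?eqxx.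
case: c => //= i c; rewrite eqSS => /and3P[sz_c /andP[i_gt0 c_gt0] /eqP <-].
exists i, c; split=> //; first by rewrite mem_iota i_gt0 add1n ltnS leq_addr.
by rewrite IH sz_c c_gt0 addKn eqxx.
Qed.

Lemma compositions_uniq k n : uniq (compositions k n).
Proof.
elim: k n => [|k IH] n /=; first by case: n.
by apply: allpairs_uniq_dep => [|i _|[i c] [j d] _ _ /= [-> ->]] //; apply: iota_uniq.
Qed.

Lemma size_compositionsS k n :
  size (compositions k.+1 n) =
  (\sum_(i < n.+1) ((0 < i) * size (compositions k (n - i))))%N.
Proof.
rewrite size_allpairs_dep sumnE big_map big_ord_recl /= mul0n add0n.
rewrite -(addn0 1%N) iotaDl big_map -[n in iota 0 n]subn0 -/(index_iota 0 n) big_mkord.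
by apply: eq_bigr => i _; rewrite mul1n.
Qed.

Section Geometric.
Variable R : comUnitRingType.

(** Comparing the coefficients of [t^(n+1)] in [(1 - t) g = 1] shows that
    consecutive coefficients of [g] are equal. *)
Lemma fps_inv_one_sub_t n : fps_inv (fps_one \- fps_t : nat -> R) n = 1.
Proof.
have U0 : (fps_one \- fps_t : nat -> R) 0%N \is a GRing.unit.
  by rewrite /fps_one /fps_t /= subr0 unitr1.
elim: n => [|n IH].
  have := fps_mulfV U0 0%N.
  by rewrite /fps_mul big_ord1 /fps_one /fps_t /= subr0 mul1r.
have := fps_mulfV U0 n.+1.
rewrite /fps_mul !big_ord_recl /= big1 => [|i _]; last first.
  by rewrite /fps_one /fps_t /= subrr mul0r.
rewrite /bump /fps_one /fps_t /= add1n subr0 mul1r sub0r addr0 subn0 subn1 IH.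
by rewrite mulN1r => /eqP; rewrite subr_eq0 => /eqP.
Qed.

(** The product of one more factor [a (t + t^2 + ...)] sums over the exponent
    [i > 0] taken from it, that is, over the first part of a composition. *)
Lemma fps_pow_geometric (a : R) k n :
  fps_pow (a \*o (fps_inv (fps_one \- fps_t) \- fps_one)) k n =
  (size (compositions k n))%:R * a ^+ k.
Proof.
elim: k n => [|k IH] n.
  by rewrite /fps_pow /= size_nseq mulr1.
rewrite /fps_pow iterS -/(fps_pow _ k) /fps_mul size_compositionsS.
rewrite natr_sum mulr_suml; apply: eq_bigr => i _.
have -> : (a \*o (fps_inv (fps_one \- fps_t) \- fps_one)) i = (0 < i)%:R * a.
  rewrite -[LHS]/(a * (fps_inv _ i - _)) fps_inv_one_sub_t /fps_one.
  by case: (val i) => [|j]; rewrite ?subrr ?subr0 ?mulr0 ?mul0r ?mulr1 ?mul1r.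
by rewrite IH natrM exprS mulrACA.
Qed.

End Geometric.

(** * Double counting *)

Section DoubleCounting.
Variables n k : nat.
Implicit Types (t : seq {bseq n of 'I_n}) (r : seq (seq 'I_n)).

(** The set whose cardinal is [lah n k]. *)
Definition lah_partitions : {set {set {bseq n of 'I_n}}} :=
  [set P : {set {bseq n of 'I_n}} |
      [&& #|P| == k,
          [forall s in P, (s != [::] :> seq 'I_n) && uniq s]
        & [forall i : 'I_n, #|[set s in P | i \in s]| == 1%N]]].

Definition ordered_blocks : seq (seq (seq 'I_n)) :=
  [seq map val t | P : {set {bseq n of 'I_n}} <- enum lah_partitions,
                   t : seq {bseq n of 'I_n} <- permutations (enum P)].

Definition cut_arrangements : seq (seq (seq 'I_n)) :=
  [seq reshape c w | w <- permutations (enum 'I_n), c <- compositions k n].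

(** The common description of the members of both enumerations. *)
Definition arranged_blocks r :=
  [&& size r == k, all (predC1 [::]) r & perm_eq (flatten r) (enum 'I_n)].

Lemma perm_enum_ord (w : seq 'I_n) :
  perm_eq w (enum 'I_n) = [forall i, count_mem i w == 1%N].
Proof.
have ct i : count_mem i (enum 'I_n) = 1%N.
  by rewrite count_uniq_mem ?enum_uniq // mem_enum.
apply/idP/forallP => [/permP eq_w i | w1]; first by rewrite eq_w ct.
by apply/allP=> i _ /=; rewrite ct w1.
Qed.

(** The covering condition on a set of blocks and the multiplicities in their
    concatenation are the same thing, since a duplicate-free block contributes
    to the multiplicity of [i] exactly when it contains [i]. *)
Lemma card_blocks_mem t i :
  uniq t -> {in t, forall s : {bseq n of 'I_n}, uniq s} ->
  #|[set s in t | i \in s]| = count_mem i (flatten (map val t)).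
Proof.
move=> Ut Us; rewrite count_flatten -map_comp sumnE big_map.
rewrite cardsE -sum1_card big_mkcondr.
rewrite -big_uniq //=.
by apply: eq_big_seq => s /Us Uss; rewrite count_uniq_mem //; case: ifP.
Qed.

(** A repeated block would repeat its elements in the concatenation, unless it
    were empty. *)
Lemma uniq_blocks (T : eqType) (ss : seq (seq T)) :
  all (predC1 [::]) ss -> uniq (flatten ss) ->
  uniq ss /\ {in ss, forall s, uniq s}.
Proof.
elim: ss => //= s ss IH /andP[s_n0 /IH{}IH].
rewrite cat_uniq => /and3P[Us /hasPn s_dis /IH[-> Uss]]; split; last first.
  by move=> u; rewrite inE => /predU1P[->|/Uss].
rewrite andbT; apply/negP => s_in.
case: s s_n0 {Us} s_in s_dis => //= x s _ s_in s_dis.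
have/s_dis: x \in flatten ss by apply/flattenP; exists (x :: s); rewrite ?mem_head.
by rewrite mem_head.
Qed.

(** Cutting and concatenating are mutually inverse, by [reshapeKr] and
    [flattenK]; the blocks are nonempty because the parts are positive. *)
Lemma mem_cut_arrangements r : (r \in cut_arrangements) = arranged_blocks r.
Proof.
apply/allpairsP/and3P => [[[w c] /= []]|[/eqP sz_r r_n0 r_enum]].
  rewrite mem_permutations mem_compositions => w_enum.
  case/and3P=> sz_c c_gt0 /eqP sum_c ->.
  have sz_w : size w = sumn c by rewrite (perm_size w_enum) size_enum_ord.
  rewrite size_reshape reshapeKr ?sz_w //; split=> //.
  have sh : shape (reshape c w) = c by rewrite reshapeKl ?sz_w.
  by move: c_gt0; rewrite -{1}sh all_map; apply: sub_all => -[].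
exists (flatten r, shape r); rewrite /= mem_permutations flattenK; split=> //.
rewrite mem_compositions size_map sz_r eqxx -size_flatten (perm_size r_enum).
by rewrite size_enum_ord eqxx andbT all_map; apply: sub_all r_n0 => -[].
Qed.

(** Forgetting the order of the blocks in an arranged sequence gives a
    partition, of which the sequence is an enumeration since its blocks are
    distinct. *)
Lemma mem_ordered_blocks r : (r \in ordered_blocks) = arranged_blocks r.
Proof.
apply/allpairsPdep/and3P => [[P [t []]]|[/eqP sz_r r_n0 r_enum]].
  rewrite mem_enum inE mem_permutations.
  case/and3P=> /eqP cardP /'forall_implyP blocksP /forallP coverP t_enum ->.
  have tP s : (s \in t) = (s \in P) by rewrite (perm_mem t_enum) mem_enum.
  have Ut : uniq t by rewrite (perm_uniq t_enum) enum_uniq.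
  split.
  - by rewrite size_map (perm_size t_enum) -cardE cardP.
  - by rewrite all_map; apply/allP=> s; rewrite tP => /blocksP/andP[].
  rewrite perm_enum_ord; apply/forallP=> i; rewrite -card_blocks_mem //.
    by rewrite -(eqP (coverP i)); apply/eqP/eq_card => s; rewrite !inE tP.
  by move=> s; rewrite tP => /blocksP/andP[].
have [Ur Us] : uniq r /\ {in r, forall s, uniq s}.
  by apply: uniq_blocks; rewrite ?(perm_uniq r_enum) ?enum_uniq.
pose t := [seq insub_bseq n s | s <- r].
(* A duplicate-free block has length at most n, so nothing is truncated. *)
have valt : map val t = r.
  rewrite -map_comp -[RHS]map_id; apply/eq_in_map => s s_r /=.
  rewrite /insub_bseq val_insubd -[X in (_ <= X)%N]size_enum_ord.
  by rewrite uniq_leq_size ?Us // => x _; rewrite mem_enum.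
have Ut : uniq t by rewrite -(map_inj_uniq val_inj) valt.
have tr s : s \in t -> val s \in r by move=> ts; rewrite -valt map_f.
have Ust : {in t, forall s : {bseq n of 'I_n}, uniq s} by move=> s /tr/Us.
exists [set s in t], t; split; last by rewrite valt.
  rewrite mem_enum inE cardsE (card_uniqP Ut) size_map sz_r eqxx /=.
  apply/andP; split.
    apply/'forall_implyP => s; rewrite inE => ts.
    by rewrite Ust // andbT; apply: (allP r_n0 _ (tr _ ts)).
  move: r_enum; rewrite perm_enum_ord => /forallP cover_r.
  apply/forallP => i; rewrite -(eqP (cover_r i)) -valt -card_blocks_mem //.
  by apply/eqP/eq_card => s; rewrite !inE.
rewrite mem_permutations; apply: uniq_perm; rewrite ?enum_uniq // => s.
by rewrite mem_enum inE.
Qed.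

(** The sequence determines the partition, as the set of its blocks. *)
Lemma ordered_blocks_uniq : uniq ordered_blocks.
Proof.
apply: allpairs_uniq_dep => [|P _|]; rewrite ?enum_uniq ?permutations_uniq //.
move=> _ _ /allpairsPdep[P [t [_ tP ->]]] /allpairsPdep[Q [u [_ uQ ->]]] /=.
move/(inj_map val_inj) => eq_tu; rewrite -eq_tu in uQ *.
suffices -> : P = Q by [].
rewrite !mem_permutations in tP uQ.
by apply/setP=> s; rewrite -[LHS]mem_enum -[RHS]mem_enum -(perm_mem tP) (perm_mem uQ).
Qed.

(** The arrangement is recovered as the concatenation of the pieces, the
    composition as the list of their lengths. *)
Lemma cut_arrangements_uniq : uniq cut_arrangements.
Proof.
apply: allpairs_uniq; rewrite ?permutations_uniq ?compositions_uniq //.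
move=> _ _ /allpairsP[[w c] /= [w_in c_in ->]] /allpairsP[[v d] /= [v_in d_in ->]] /=.
have sumE u e : u \in permutations (enum 'I_n) -> e \in compositions k n ->
    size u = sumn e.
  rewrite mem_permutations mem_compositions => /perm_size-> /and3P[_ _ /eqP->].
  by rewrite size_enum_ord.
have szw := sumE _ _ w_in c_in; have szv := sumE _ _ v_in d_in.
move=> eq_r; congr (_, _).
  by rewrite -(@reshapeKr _ c w) ?szw // eq_r reshapeKr ?szv.
by rewrite -(@reshapeKl _ c w) ?szw // eq_r reshapeKl ?szv.
Qed.

Lemma lah_fact : (lah n k * k`! = n`! * size (compositions k n))%N.
Proof.
have <- : size ordered_blocks = (lah n k * k`!)%N.
  rewrite size_allpairs_dep sumnE big_map big_enum /=.
  rewrite (eq_bigr (fun=> k`!)) ?sum_nat_const // => P.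
  rewrite inE => /and3P[/eqP cardP _ _].
  by rewrite size_permutations ?enum_uniq // -cardE cardP.
have <- : size cut_arrangements = (n`! * size (compositions k n))%N.
  by rewrite size_allpairs size_permutations ?enum_uniq // size_enum_ord.
apply/perm_size/uniq_perm => [||r].
- exact: ordered_blocks_uniq.
- exact: cut_arrangements_uniq.
by rewrite mem_ordered_blocks mem_cut_arrangements.
Qed.

End DoubleCounting.

(** * The generating function *)

Lemma fact_unit_poly (F : fieldType) (charF0 : [pchar F] =i pred0) m :
  m`!%:R \is a @GRing.unit {poly F}.
Proof.
rewrite -polyC_natr poly_unitE size_polyC coefC eqxx unitfE.
by move/pcharf0P: charF0 => ->; rewrite -lt0n fact_gt0.
Qed.

Theorem lemma4 (F : fieldType) (charF0 : [pchar F] =i pred0) :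
  fps_exp ('X \*o (fps_inv (fps_one \- fps_t) \- fps_one))
    =1 fps_egf (fun n => lah_bell F n).
Proof.
move=> n; rewrite /fps_exp /fps_egf /lah_bell mulr_suml.
apply: eq_bigr => k _; rewrite fps_pow_geometric.
apply: (canLR (mulrK (fact_unit_poly _ charF0 k))).
rewrite [RHS]mulrAC; apply: (canRL (mulrK (fact_unit_poly _ charF0 n))).
rewrite scaler_nat -['X^k *+ _]mulr_natl mulrAC [RHS]mulrAC -!natrM.
by rewrite lah_fact mulnC.
Qed.
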